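(* Let $\mathcal{C}\subseteq\mathbb{D}$ be any compact set of states and let $\mathcal{O}\subseteq\mathcal{O}_{\mathrm{RNG}}$ be a chosen set of completely positive maps. Suppose that the cone $\mathcal{C}^{**}$ is closed under the operations in $\mathcal{O}$, i.e. $X\in\mathcal{C}^{**}\Rightarrow\Lambda(X)\in\mathcal{C}^{**}$ for all $\Lambda\in\mathcal{O}$. Then for any quantum channel $\Theta=\sum_i\Theta_i$ (finite sum) such that each $\Theta_i\in\mathcal{O}$, and any $\rho\in\mathbb{D}$, it holds that $$R^{\mathcal{C}}_{\mathcal{S}_+}(\rho)\ \ge\ \sum_i p_i\,R^{\mathcal{C}}_{\mathcal{S}_+}\!\left(\frac{\Theta_i(\rho)}{p_i}\right)$$ for any $p_i\in\mathbb{R}_+$ with $\sum_i p_i=1$ (terms with $p_i=0$ being omitted).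
   Context: Fix $d\ge 1$. $\mathcal{V}\subseteq\mathbb{C}^d$ is a nonempty compact set of unit vectors such that $|\psi\rangle\in\mathcal{V}$ implies $e^{i\theta}|\psi\rangle\in\mathcal{V}$ for all real $\theta$. $\mathbb{H}$ is the real vector space of $d\times d$ Hermitian matrices and $\mathbb{D}\subseteq\mathbb{H}$ the set of density matrices. Put $\mathcal{S}_+=\{|v\rangle\langle v| : |v\rangle\in\mathcal{V}\}$. For compact $\mathcal{A}\subseteq\mathbb{D}$, $\mathcal{A}^{**}=\mathbb{R}_+\mathrm{conv}(\mathcal{A})$ denotes the convex cone generated by $\mathcal{A}$. The robustness with respect to $\mathcal{C}$ is $$R^{\mathcal{C}}_{\mathcal{S}_+}(X)=\inf\{s\in\mathbb{R}_+ : \exists\,\omega\in\mathrm{conv}(\mathcal{C}),\ X+s\,\omega\in\mathcal{S}_+^{**}\}\in[0,\infty],\qquad \inf\emptyset=\infty,$$ the formula being used for any $X\in\mathbb{H}$. $\mathcal{O}_{\mathrm{RNG}}$ is the set of resource non-generating operations: completely positive linear maps $\Phi$ on $d\times d$ matrices (not necessarily trace-preserving) with $\sigma\in\mathcal{S}_+^{**}\Rightarrow\Phi(\sigma)\in\mathcal{S}_+^{**}$. A quantum channel is a completely positive trace-preserving linear map. *)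

(* Defs.v *)
From HB Require Import structures.
From mathcomp Require Import all_boot all_order all_algebra.
From mathcomp Require Import all_classical all_reals all_analysis.
From mathcomp Require Import complex.

Set Implicit Arguments.
Unset Strict Implicit.
Unset Printing Implicit Defensive.

Import Order.TTheory GRing.Theory Num.Theory.
Import numFieldNormedType.Exports.

Local Open Scope classical_set_scope.
Local Open Scope ring_scope.
Local Open Scope complex_scope.
Local Open Scope sesquilinear_scope.

Definition positive_semidefinite (R : realType) (n : nat) (A : 'M[R[i]]_n) : Prop :=
  A \is hermsymmx /\ forall v : 'cV[R[i]]_n, 0 <= (v ^t* *m A *m v) 0 0.

Definition density_matrices (R : realType) (d : nat) : set 'M[R[i]]_d :=
  [set rho | positive_semidefinite rho /\ \tr rho = 1].

(* The order on R[i] makes a scalar in [0, 1] real, so [convex_set] over R[i]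
   is convexity with real weights. *)
Definition convex_hull (R : realType) (d : nat) (A : set 'M[R[i]]_d) :
    set 'M[R[i]]_d :=
  smallest (@convex_set R[i] 'M[R[i]]_d) A.

Definition cone_hull (R : realType) (d : nat) (A : set 'M[R[i]]_d) :
    set 'M[R[i]]_d :=
  [set X | exists2 t : R, 0 <= t & exists2 Y, convex_hull A Y & X = t%:C *: Y].

Definition pure_states (R : realType) (d : nat) (V : set 'cV[R[i]]_d) :
    set 'M[R[i]]_d :=
  [set v *m v ^t* | v in V].

(* [robustness C S X] is the robustness of X with respect to C, relative to the
   free states S; [ereal_inf set0] is [+oo]. *)
Definition robustness (R : realType) (d : nat) (C S : set 'M[R[i]]_d)
    (X : 'M[R[i]]_d) : \bar R :=
  ereal_inf [set s%:E | s in [set s : R | 0 <= s /\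
    exists2 omega, convex_hull C omega & cone_hull S (X + s%:C *: omega)]].

(* For every k, id_k (x) Phi is positive; it acts on a matrix of k * k blocks of
   size d * d by applying Phi to each block. *)
Definition completely_positive (R : realType) (d : nat)
    (Phi : 'End('M[R[i]]_d)) : Prop :=
  forall (k : nat) (X : 'M[R[i]]_(\sum_(i < k) d)),
    positive_semidefinite X ->
    positive_semidefinite (\mxblock_(i < k, j < k) Phi (submxblock X i j)).

Definition trace_preserving (R : realType) (d : nat)
    (Phi : 'End('M[R[i]]_d)) : Prop :=
  forall X, \tr (Phi X) = \tr X.

Definition quantum_channel (R : realType) (d : nat)
    (Phi : 'End('M[R[i]]_d)) : Prop :=
  completely_positive Phi /\ trace_preserving Phi.

Definition resource_nongenerating (R : realType) (d : nat)
    (S : set 'M[R[i]]_d) : set 'End('M[R[i]]_d) :=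
  [set Phi | completely_positive Phi /\
    forall sigma, cone_hull S sigma -> cone_hull S (Phi sigma)].

(* Main.v *)
(* If rho + s omega lies in the cone over the free states, so does its image
   under each Theta_i.  As Theta_i omega = t_i omega_i with omega_i in conv C,
   dividing by p_i bounds the robustness of Theta_i rho / p_i by s t_i / p_i.
   Elements of conv C have trace 1 and Theta preserves the trace, so the t_i
   sum to 1 and the weighted bounds add up to at most s. *)
Require Import Defs.
From HB Require Import structures.
From mathcomp Require Import all_boot all_order all_algebra.
From mathcomp Require Import all_classical all_reals all_analysis.
From mathcomp Require Import complex.
Import Order.TTheory GRing.Theory Num.Theory.
Import numFieldNormedType.Exports.
Local Open Scope classical_set_scope.
Local Open Scope ring_scope.
Local Open Scope complex_scope.
Local Open Scope sesquilinear_scope.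

Lemma cone_hullZ (R : realType) (d : nat) (A : set 'M[R[i]]_d) (X : 'M[R[i]]_d)
  (a : R) : 0 <= a -> cone_hull A X -> cone_hull A (a%:C *: X).
Proof.
move=> a_ge0 [t t_ge0 [Y AY ->]]; exists (a * t); first exact: mulr_ge0.
by exists Y => //; rewrite scalerA rmorphM.
Qed.

Lemma convex_hull_cone (R : realType) (d : nat) (A : set 'M[R[i]]_d)
  (X : 'M[R[i]]_d) : convex_hull A X -> cone_hull A X.
Proof. by move=> AX; exists 1 => //; exists X => //; rewrite rmorph1 scale1r. Qed.

(** The trace is affine on combinations with weights [k] and [1 - k], so its level set at [c] is
    convex and contains the hull. *)
Lemma convex_hull_trace (R : realType) (d : nat) (A : set 'M[R[i]]_d) (c : R[i]) :
  (forall X, A X -> \tr X = c) -> forall X, convex_hull A X -> \tr X = c.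
Proof.
move=> trA; apply: smallest_sub => // X Y k.
rewrite !inE /= => trX trY.
by rewrite mxtraceD !mxtraceZ trX trY -mulrDl addrC subrK mul1r.
Qed.

Lemma robustness_le (R : realType) (d : nat) (C S : set 'M[R[i]]_d)
  (X omega : 'M[R[i]]_d) (s : R) :
  0 <= s -> convex_hull C omega -> cone_hull S (X + s%:C *: omega) ->
  (robustness C S X <= s%:E)%E.
Proof.
move=> s_ge0 Comega SX; apply: ereal_inf_lbound.
by exists s => //; split=> //; exists omega.
Qed.

Theorem theorem20 (R : realType) (d : nat) (hd : (0 < d)%N)
  (V : set 'cV[R[i]]_d)
  (V_nonempty : V !=set0)
  (V_compact : compact (V : set 'cV[R[i]^o]_d))
  (V_unit : forall psi, V psi -> psi ^t* *m psi = 1%:M)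
  (V_phase : forall psi (theta : R), V psi ->
     V ((cos theta +i* sin theta) *: psi))
  (C : set 'M[R[i]]_d)
  (C_compact : compact (C : set 'M[R[i]^o]_d))
  (C_density : C `<=` @density_matrices R d)
  (O : set 'End('M[R[i]]_d))
  (O_RNG : O `<=` resource_nongenerating (pure_states V))
  (O_cone : forall Lambda, O Lambda ->
     forall X, cone_hull C X -> cone_hull C (Lambda X))
  (I : finType) (Theta_ : I -> 'End('M[R[i]]_d)) (Theta : 'End('M[R[i]]_d))
  (Theta_channel : quantum_channel Theta)
  (Theta_sum : Theta = \sum_i Theta_ i)
  (Theta_O : forall i, O (Theta_ i))
  (rho : 'M[R[i]]_d) (rho_density : density_matrices rho)
  (p : I -> R) (p_ge0 : forall i, 0 <= p i) (p_sum : \sum_i p i = 1) :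
  (robustness C (pure_states V) rho >=
   \sum_(i | p i != 0%R)
     (p i)%:E * robustness C (pure_states V) ((p i)^-1%:C *: Theta_ i rho))%E.
Proof.
(* It suffices to bound the sum by each feasible [s]; with no feasible [s] the infimum is [+oo]. *)
apply: le_ereal_inf_tmp => _ [s [s_ge0 [omega Comega Srho]] <-].
have C_trace X : convex_hull C X -> \tr X = 1.
  by move: X; apply: convex_hull_trace => X /C_density[].
have /choice[t t_omega] i : exists t : R, 0 <= t /\
    exists2 omega_i, convex_hull C omega_i & Theta_ i omega = t%:C *: omega_i.
  have [t t_ge0 Ht] := O_cone _ (Theta_O i) _ (convex_hull_cone _ _ _ _ Comega).
  by exists t.
have t_sum : \sum_i t i = 1.
  (* Traces are complex, so the real identity is proved after embedding into [R[i]], where 1 is read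
     as the trace of [omega]. *)
  apply: (@complexI R); rewrite rmorph1 -(C_trace _ Comega).
  rewrite -Theta_channel.2 Theta_sum sum_lfunE !raddf_sum /=.
  apply: eq_bigr => i _; have [_ [omega_i Ci ->]] := t_omega i.
  by rewrite mxtraceZ (C_trace _ Ci) mulr1.
have le_term i : p i != 0 ->
    ((p i)%:E * robustness C (pure_states V) ((p i)^-1%:C *: Theta_ i rho)
     <= (s * t i)%:E)%E.
  move=> pi_neq0; have [t_ge0 [omega_i Ci Theta_omega]] := t_omega i.
  have -> : s * t i = p i * ((p i)^-1 * (s * t i)) by rewrite mulVKf.
  rewrite EFinM lee_wpmul2l ?lee_fin//.
  apply: (robustness_le _ _ _ _ _ omega_i) => //.
    by rewrite !mulr_ge0 ?invr_ge0.
  (* By linearity the perturbed state is the image of [rho + s omega], rescaled by the inverse of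
     [p i]; both operations preserve the free cone. *)
  have -> : (p i)^-1%:C *: Theta_ i rho + ((p i)^-1 * (s * t i))%:C *: omega_i
      = (p i)^-1%:C *: Theta_ i (rho + s%:C *: omega).
    by rewrite linearD linearZ /= Theta_omega scalerDr !scalerA !rmorphM /= !mulrA.
  apply: cone_hullZ; first by rewrite invr_ge0.
  exact: (O_RNG _ (Theta_O i)).2.
apply: le_trans (lee_sum _ le_term) _.
(* Write [s] as the sum of [s * t i] over all [i]: the indices with [p i = 0] contribute 0 on the
   left and a nonnegative term on the right. *)
rewrite sumEFin lee_fin -[leRHS]mulr1 -t_sum mulr_sumr big_mkcond /=.
apply: ler_sum => i _; case: ifP => // _.
by rewrite mulr_ge0 ?(t_omega i).1.
Qed.
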